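(* Let $f\colon\mathbb{R}^n\to\mathbb{R}$ be locally Lipschitz continuous, let $\Phi\colon\mathbb{R}^n\rightrightarrows\mathbb{R}^m$ be a set-valued mapping with closed graph, and let $M:=\{x\in\mathbb{R}^n\mid 0\in\Phi(x)\}$. Let $\bar x\in M$ be a local minimizer of the problem of minimizing $f(x)$ subject to $0\in\Phi(x)$, and assume that $\bar x$ is AM-regular. Then $\bar x$ is an M-stationary point of this problem, i.e., there exists $\lambda\in\mathbb{R}^m$ such that $$0\in\partial f(\bar x)+D^*\Phi(\bar x,0)(\lambda).$$
   Context: Normal cones: for a set $A\subset\mathbb{R}^d$ and $\bar a\in A$, the tangent (Bouligand) cone is $\mathcal{T}_A(\bar a):=\{d\mid \exists t_k\searrow 0,\ d_k\to d\colon \bar a+t_kd_k\in A\ \forall k\}$, the regular normal cone is its polar $\widehat{\mathcal{N}}_A(\bar a):=\{v\mid v^\top d\le 0\ \forall d\in\mathcal{T}_A(\bar a)\}$, and the limiting normal cone is $\mathcal{N}_A(\bar a):=\{v\mid\exists a_k\to\bar a,\ a_k\in A,\ v_k\to v,\ v_k\in\widehat{\mathcal{N}}_A(a_k)\ \forall k\}$. All these sets are empty at points outside $A$. Limiting subdifferential: $\partial f(\bar x):=\{v\in\mathbb{R}^n\mid (v,-1)\in\mathcal{N}_{\operatorname{epi}f}(\bar x,f(\bar x))\}$, where $\operatorname{epi}f:=\{(x,\alpha)\mid\alpha\ge f(x)\}$. Limiting coderivative: with $\operatorname{gph}\Phi:=\{(x,y)\mid y\in\Phi(x)\}$, set $D^*\Phi(x,y)(y^*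 ):=\{x^*\in\mathbb{R}^n\mid (x^*,-y^* )\in\mathcal{N}_{\operatorname{gph}\Phi}(x,y)\}$ for $y^*\in\mathbb{R}^m$ (empty if $(x,y)\notin\operatorname{gph}\Phi$). AM-regularity: let $\mathcal{M}(x,y):=\bigcup_{\lambda\in\mathbb{R}^m}D^*\Phi(x,y)(\lambda)\subset\mathbb{R}^n$ for $(x,y)\in\mathbb{R}^n\times\mathbb{R}^m$. A point $\bar x\in M$ is asymptotically Mordukhovich-regular (AM-regular) if $\limsup_{x\to\bar x,\,y\to0}\mathcal{M}(x,y)\subset\mathcal{M}(\bar x,0)$, where the left-hand side is the Painlevé–Kuratowski outer limit, i.e., the set of all $x^*\in\mathbb{R}^n$ for which there are sequences $x_k\to\bar x$, $y_k\to0$, $x_k^*\to x^*$ with $x_k^*\in\mathcal{M}(x_k,y_k)$ for all $k\in\mathbb{N}$. *)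

(* Defs.v *)
From HB Require Import structures.
From mathcomp Require Import all_boot all_order all_algebra.
From mathcomp Require Import all_classical all_reals all_analysis.

Set Implicit Arguments.
Unset Strict Implicit.
Unset Printing Implicit Defensive.

Import Order.TTheory GRing.Theory Num.Theory.
Import numFieldNormedType.Exports.

Local Open Scope classical_set_scope.
Local Open Scope ring_scope.

(* R^d is 'rV[R]_d; a pair (x, y) of R^n x R^m is the concatenation
   row_mx x y in R^(n + m), and a scalar c is the vector c%:M of R^1.  The
   library norm on 'rV[R]_d is the sup norm: only its topology and its class of
   Lipschitz functions are used, and these are those of the Euclidean norm. *)

Definition tangent_cone (R : realType) (d : nat) (A : set 'rV[R]_d)
    (a : 'rV[R]_d) : set 'rV[R]_d :=
  [set w | A a /\
    exists t : nat -> R, exists w_ : nat -> 'rV[R]_d,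
      [/\ forall k, 0 < t k,
          t @ \oo --> 0,
          w_ @ \oo --> w &
          forall k, A (a + t k *: w_ k)]].

Definition regular_normal_cone (R : realType) (d : nat) (A : set 'rV[R]_d)
    (a : 'rV[R]_d) : set 'rV[R]_d :=
  [set v | A a /\ forall w, tangent_cone A a w -> (v *m w^T) 0 0 <= 0].

Definition limiting_normal_cone (R : realType) (d : nat) (A : set 'rV[R]_d)
    (a : 'rV[R]_d) : set 'rV[R]_d :=
  [set v | A a /\
    exists a_ : nat -> 'rV[R]_d, exists v_ : nat -> 'rV[R]_d,
      [/\ forall k, A (a_ k),
          a_ @ \oo --> a,
          v_ @ \oo --> v &
          forall k, regular_normal_cone A (a_ k) (v_ k)]].

Definition epi (R : realType) (n : nat) (f : 'rV[R]_n -> R) :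
    set 'rV[R]_(n + 1) :=
  [set z | rsubmx z 0 0 >= f (lsubmx z)].

Definition limiting_subdifferential (R : realType) (n : nat)
    (f : 'rV[R]_n -> R) (x : 'rV[R]_n) : set 'rV[R]_n :=
  [set v | limiting_normal_cone (epi f) (row_mx x (f x)%:M)
             (row_mx v (-1)%:M)].

Definition gph (R : realType) (n m : nat) (Phi : 'rV[R]_n -> set 'rV[R]_m) :
    set 'rV[R]_(n + m) :=
  [set z | Phi (lsubmx z) (rsubmx z)].

Definition coderivative (R : realType) (n m : nat)
    (Phi : 'rV[R]_n -> set 'rV[R]_m) (x : 'rV[R]_n) (y ystar : 'rV[R]_m) :
    set 'rV[R]_n :=
  [set xstar | limiting_normal_cone (gph Phi) (row_mx x y)
                 (row_mx xstar (- ystar))].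

Definition coderivative_range (R : realType) (n m : nat)
    (Phi : 'rV[R]_n -> set 'rV[R]_m) (x : 'rV[R]_n) (y : 'rV[R]_m) :
    set 'rV[R]_n :=
  \bigcup_(lambda in [set: 'rV[R]_m]) coderivative Phi x y lambda.

(* Painleve-Kuratowski outer limit of S at (x, y) *)
Definition outer_limit (R : realType) (n m p : nat)
    (S : 'rV[R]_n -> 'rV[R]_m -> set 'rV[R]_p) (x : 'rV[R]_n) (y : 'rV[R]_m) :
    set 'rV[R]_p :=
  [set s | exists x_ : nat -> 'rV[R]_n, exists y_ : nat -> 'rV[R]_m,
           exists s_ : nat -> 'rV[R]_p,
      [/\ x_ @ \oo --> x,
          y_ @ \oo --> y,
          s_ @ \oo --> s &
          forall k, S (x_ k) (y_ k) (s_ k)]].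

Definition feasible_set (R : realType) (n m : nat)
    (Phi : 'rV[R]_n -> set 'rV[R]_m) : set 'rV[R]_n :=
  [set x | Phi x 0].

Definition AM_regular (R : realType) (n m : nat)
    (Phi : 'rV[R]_n -> set 'rV[R]_m) (x : 'rV[R]_n) : Prop :=
  feasible_set Phi x /\
  outer_limit (coderivative_range Phi) x 0 `<=` coderivative_range Phi x 0.

(* The library's [locally [lipschitz f x | x in setT]] ranges over
   neighbourhoods of all pairs of points, not only of diagonal ones. *)
Definition locally_lipschitz (R : realType) (n : nat) (f : 'rV[R]_n -> R) :
    Prop :=
  forall x : 'rV[R]_n, exists2 U : set 'rV[R]_n,
    nbhs x U & [lipschitz f z | z in U].

Definition local_minimizer (R : realType) (n : nat) (f : 'rV[R]_n -> R)
    (A : set 'rV[R]_n) (x : 'rV[R]_n) : Prop :=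
  A x /\ \forall z \near x, A z -> f x <= f z.

Definition M_stationary (R : realType) (n m : nat) (f : 'rV[R]_n -> R)
    (Phi : 'rV[R]_n -> set 'rV[R]_m) (x : 'rV[R]_n) : Prop :=
  exists lambda : 'rV[R]_m,
    [set u + v | u in limiting_subdifferential f x
               & v in coderivative Phi x 0 lambda] 0.

(* Main.v *)
(* Minimise f x + k/2 (|x - x'|^2 + |y|^2) + 1/2 |x' - xbar|^2 over x near xbar
   and (x', y) in gph Phi near (xbar, 0).  The minimisers tend to
   (xbar, xbar, 0), and the decoupling of x from x' makes the two blocks
   separately optimal: with xi_k = k (x_k - x'_k), the vectors (-xi_k, -1) and
   (xi_k - (x'_k - xbar), - k y_k) are proximal normals to epi f and to gph Phi.
   The Lipschitz constant L bounds |xi_k| by 2 L, so xi_k clusters at some xi.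
   Then -xi is a limiting subgradient at xbar, and AM-regularity, rather than a
   bound on the multipliers k y_k, places xi in the range of the coderivative. *)

Require Import Defs.
From HB Require Import structures.
From mathcomp Require Import all_boot all_order all_algebra.
From mathcomp Require Import all_classical all_reals all_analysis.
From mathcomp Require Import ring lra.

Set Implicit Arguments.
Unset Strict Implicit.
Unset Printing Implicit Defensive.

Import Order.TTheory GRing.Theory Num.Theory.
Import numFieldNormedType.Exports.

Local Open Scope classical_set_scope.
Local Open Scope ring_scope.

(** * Row vectors: Euclidean inner product against the sup norm, limits, proximal normals *)

Section Dot.
Context {R : realType}.

(** Kept as a matrix product so that it is convertible to the pairing in [regular_normal_cone]. *)
Definition dot {d : nat} (u v : 'rV[R]_d) : R := (u *m v^T) 0 0.

Lemma dotE d (u v : 'rV[R]_d) : dot u v = \sum_j u 0 j * v 0 j.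
Proof. by rewrite /dot mxE; apply: eq_bigr => j _; rewrite mxE. Qed.

Lemma dotC d (u v : 'rV[R]_d) : dot u v = dot v u.
Proof. by rewrite !dotE; apply: eq_bigr => j _; rewrite mulrC. Qed.

Lemma dotDl d (u v w : 'rV[R]_d) : dot (u + v) w = dot u w + dot v w.
Proof. by rewrite /dot mulmxDl mxE. Qed.

Lemma dotDr d (u v w : 'rV[R]_d) : dot w (u + v) = dot w u + dot w v.
Proof. by rewrite dotC dotDl !(dotC w). Qed.

Lemma dotNl d (u v : 'rV[R]_d) : dot (- u) v = - dot u v.
Proof. by rewrite /dot mulNmx mxE. Qed.

Lemma dotZl d (c : R) (u v : 'rV[R]_d) : dot (c *: u) v = c * dot u v.
Proof. by rewrite /dot -scalemxAl mxE. Qed.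

Lemma dotZr d (c : R) (u v : 'rV[R]_d) : dot u (c *: v) = c * dot u v.
Proof. by rewrite dotC dotZl dotC. Qed.

Lemma dot_row_mx d e (u u' : 'rV[R]_d) (v v' : 'rV[R]_e) :
  dot (row_mx u v) (row_mx u' v') = dot u u' + dot v v'.
Proof. by rewrite /dot tr_row_mx mul_row_col mxE. Qed.

Lemma dot_lrsubmx d e (u u' : 'rV[R]_(d + e)) :
  dot u u' = dot (lsubmx u) (lsubmx u') + dot (rsubmx u) (rsubmx u').
Proof. by rewrite -dot_row_mx !hsubmxK. Qed.

Lemma dot_rV1 (u v : 'rV[R]_1) : dot u v = u 0 0 * v 0 0.
Proof. by rewrite dotE big_ord1. Qed.

(** Expanding around [u] splits the change of a squared distance into a gradient term and a
    quadratic remainder; this turns minimality into a proximal inequality. *)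
Lemma dot_sqrB d (c u v : 'rV[R]_d) :
  dot (v - c) (v - c)
  = dot (u - c) (u - c) + 2 * dot (u - c) (v - u) + dot (v - u) (v - u).
Proof.
have -> : v - c = (u - c) + (v - u) by rewrite [RHS]addrC subrKA.
move: (u - c) (v - u) => x y; rewrite dotDl !dotDr (dotC y x); ring.
Qed.

Lemma dot_sqrC d (u v : 'rV[R]_d) : dot (u - v) (u - v) = dot (v - u) (v - u).
Proof. by rewrite -opprB dotNl dotC dotNl opprK. Qed.

Lemma dot_ge0 d (u : 'rV[R]_d) : 0 <= dot u u.
Proof. by rewrite dotE; apply: sumr_ge0 => j _; rewrite -expr2 sqr_ge0. Qed.

(** A nonzero sup norm is attained at some coordinate, whose square is one summand of [dot u u]. *)
Lemma sqr_normr_le_dot d (u : 'rV[R]_d) : `|u| ^+ 2 <= dot u u.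
Proof.
have [u0|/mx_norm_neq0 [[i j] /= E]] := eqVneq (mx_norm u) 0.
  by rewrite (u0 : `|u| = 0) expr0n /= dot_ge0.
rewrite (E : `|u| = _) (ord1 i) real_normK ?num_real// dotE (bigD1 j)//=.
rewrite -expr2 lerDl.
by apply: sumr_ge0 => k _; rewrite -expr2 sqr_ge0.
Qed.

Lemma normr_coord_le p q (u : 'M[R]_(p, q)) i j : `|u i j| <= `|u|.
Proof.
rewrite [leRHS]/Num.norm /= mx_normrE; apply/bigmax_geP; right => /=.
by exists (i, j).
Qed.

Lemma normr_mx_le p q (u : 'M[R]_(p, q)) (M : R) :
  0 <= M -> (forall i j, `|u i j| <= M) -> `|u| <= M.
Proof.
move=> M0 uM; have [u0|/mx_norm_neq0 [[i j] /= E]] := eqVneq (mx_norm u) 0.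
  by rewrite (u0 : `|u| = 0).
by rewrite (E : `|u| = _).
Qed.

Lemma normr_lsubmx_le d e (u : 'rV[R]_(d + e)) : `|lsubmx u| <= `|u|.
Proof. by apply: normr_mx_le => // i j; rewrite mxE normr_coord_le. Qed.

Lemma normr_rsubmx_le d e (u : 'rV[R]_(d + e)) : `|rsubmx u| <= `|u|.
Proof. by apply: normr_mx_le => // i j; rewrite mxE normr_coord_le. Qed.

Lemma normr_row_mx_le d e (u : 'rV[R]_d) (v : 'rV[R]_e) (M : R) :
  `|u| <= M -> `|v| <= M -> `|row_mx u v| <= M.
Proof.
move=> uM vM; apply: normr_mx_le => [|i j]; first exact: le_trans uM.
rewrite mxE; case: splitP => k _.
  by apply: le_trans uM; exact: normr_coord_le.
by apply: le_trans vM; exact: normr_coord_le.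
Qed.

Lemma cvg_coord (T : Type) (F : set_system T) {FF : Filter F} p q
    (g : T -> 'M[R]_(p, q)) (l : 'M[R]_(p, q)) i j :
  g @ F --> l -> g x i j @[x --> F] --> l i j.
Proof.
move=> gl; apply: (@cvg_comp _ _ _ g (fun M : 'M[R]_(p, q) => M i j)) gl _.
exact: coord_continuous.
Qed.

(** A neighbourhood of a matrix contains a product of neighbourhoods of its entries; there are
    finitely many, so the filter handles them together. *)
Lemma cvg_mx (T : Type) (F : set_system T) {FF : Filter F} p q
    (g : T -> 'M[R]_(p, q)) (l : 'M[R]_(p, q)) :
  (forall i j, g x i j @[x --> F] --> l i j) -> g @ F --> l.
Proof.
move=> gl A [P lP PA]; rewrite /fmap /=.
apply: (@filterS _ _ _ [set x | forall i j, P i j (g x i j)]).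
  by move=> x Px; apply: PA.
apply: filter_forall => i; apply: filter_forall => j; exact: gl (lP i j).
Qed.

Lemma cvg_row_mx (T : Type) (F : set_system T) {FF : Filter F} d e
    (g : T -> 'rV[R]_d) (h : T -> 'rV[R]_e) (a : 'rV[R]_d) (b : 'rV[R]_e) :
  g @ F --> a -> h @ F --> b -> row_mx (g x) (h x) @[x --> F] --> row_mx a b.
Proof.
move=> ga hb; apply: cvg_mx => i j; rewrite mxE.
under eq_fun do rewrite mxE.
by case: (fintype.split j) => k; exact: cvg_coord.
Qed.

Lemma cvg_row_mxE (T : Type) (F : set_system T) {FF : Filter F} d e
    (g : T -> 'rV[R]_d) (h : T -> 'rV[R]_e) (l : 'rV[R]_(d + e)) :
  row_mx (g x) (h x) @[x --> F] --> l ->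
  g @ F --> lsubmx l /\ h @ F --> rsubmx l.
Proof.
move=> ghl; split.
  have -> : g = fun x => lsubmx (row_mx (g x) (h x)).
    by apply/funext => x; rewrite row_mxKl.
  by apply: continuous_cvg ghl; exact: continuous_lsubmx.
have -> : h = fun x => rsubmx (row_mx (g x) (h x)).
  by apply/funext => x; rewrite row_mxKr.
by apply: continuous_cvg ghl; exact: continuous_rsubmx.
Qed.

Lemma cvg_dot (T : Type) (F : set_system T) {FF : Filter F} d
    (g h : T -> 'rV[R]_d) (a b : 'rV[R]_d) :
  g @ F --> a -> h @ F --> b -> dot (g x) (h x) @[x --> F] --> dot a b.
Proof.
move=> ga hb; rewrite dotE; under eq_fun do rewrite dotE.
apply: cvg_big => [|j _]; first exact: add_continuous.
by apply: cvgM; exact: cvg_coord.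
Qed.

(** Compactness of the closed ball gives a cluster point. The bound [j <= s j] later turns a rate in
    [s j] into a rate in [j]. *)
Lemma bolzano_weierstrass_rV d (u : nat -> 'rV[R]_d) (M : R) :
  (forall k, `|u k| <= M) ->
  exists (s : nat -> nat) (l : 'rV[R]_d),
    (forall j, (j <= s j)%N) /\ u (s j) @[j --> \oo] --> l.
Proof.
move=> uM; pose K : set 'rV[R]_d := [set x | `|x| <= M].
have cK : compact K.
  apply: bounded_closed_compact.
    exists M; split=> [|N MN x /= xM]; first exact: num_real.
    exact: le_trans xM (ltW MN).
  apply: (@closed_comp _ _ (fun x : 'rV[R]_d => `|x|) [set y | y <= M]).
    by move=> x _; exact: norm_continuous.
  exact: closed_le.
have [l [_ cl]] : K `&` cluster (u @ \oo) !=set0.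
  by apply: cK; exists 0%N => // k _; exact: uM.
have /choice [s Hs] : forall j, exists k, (j <= k)%N /\ `|l - u k| < j.+1%:R^-1.
  move=> j; have [||y [[k /= jk <-] ky]] :=
    cl (u @` [set k | (j <= k)%N]) (ball l j.+1%:R^-1).
  - by exists j => // k jk; exists k.
  - by apply: nbhsx_ballx; rewrite invr_gt0 ltr0n.
  by exists k; split=> //; move: ky; rewrite -ball_normE.
exists s, l; split=> [j|]; first by have [] := Hs j.
apply/cvgrPdist_lt => e e0; near=> j.
have [_ /lt_trans] := Hs j; apply.
near: j; have /cvgrPdist_lt /(_ e e0) := @cvg_harmonic R.
apply: filterS => j.
by rewrite /harmonic /= sub0r normrN gtr0_norm// invr_gt0 ltr0n.
Unshelve. all: by end_near. Qed.

(** Along a tangent sequence, dividing the inequality by [t k] leaves a right-hand side of order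
    [t k], which vanishes in the limit. *)
Lemma proximal_normal_regular d (A : set 'rV[R]_d) (a v : 'rV[R]_d) (C : R) :
  A a ->
  (\forall z \near a, A z -> dot v (z - a) <= C * dot (z - a) (z - a)) ->
  regular_normal_cone A a v.
Proof.
move=> Aa nearC; split=> // w [_ [t [w_ [t0 tt0 ww Atw]]]].
(* Zero takes the form of the limit of [C * t k * dot (w_ k) (w_ k)]. *)
rewrite -/(dot v w) -[leRHS](mul0r (dot w w)).
have tw0 : t k *: w_ k @[k --> \oo] --> (0 : 'rV[R]_d).
  by rewrite -(scale0r w); exact: cvgZ.
have aw : a + t k *: w_ k @[k --> \oo] --> a.
  by rewrite -[X in _ --> X]addr0; apply: cvgD => //; exact: cvg_cst.
apply: (@ler_cvg_to nat \oo _ R (fun k => dot v (w_ k))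
  (fun k => C * t k * dot (w_ k) (w_ k))).
- by apply: cvg_dot => //; exact: cvg_cst.
- apply: cvgM; last exact: cvg_dot.
  by rewrite -(mulr0 C); apply: cvgM tt0; exact: cvg_cst.
- have nearaw : \forall k \near \oo, A (a + t k *: w_ k) ->
      dot v (a + t k *: w_ k - a)
      <= C * dot (a + t k *: w_ k - a) (a + t k *: w_ k - a) := aw _ nearC.
  apply: filterS nearaw => k /(_ (Atw k)).
  by rewrite [a + _]addrC addrK dotZl !dotZr mulrCA ler_pM2l// mulrA.
Qed.

End Dot.

(** * Local Lipschitz continuity on closed balls *)

Lemma locally_lipschitz_ball (R : realType) n (f : 'rV[R]_n -> R) :
  locally_lipschitz f -> forall x, exists r L : R, [/\ 0 < r, 0 <= L &
    forall y z, `|x - y| <= r -> `|x - z| <= r -> `|f y - f z| <= L * `|y - z|].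
Proof.
move=> fl x; have [U /nbhs_ballP [e /= e0 eU] [M [Mr lipM]]] := fl x.
(* Halving [e] puts the closed ball inside the open one. The Lipschitz bound holds for every
   constant above [M], and this one is nonnegative. *)
exists (e / 2), (`|M| + 1); split=> [|//|y z xy xz]; first exact: divr_gt0.
have inU u : `|x - u| <= e / 2 -> U u.
  move=> xu; apply: eU; rewrite -ball_normE /=; apply: le_lt_trans xu _.
  by rewrite ltr_pdivrMr// ltr_pMr// ltr1n.
have MM : M < `|M| + 1 by rewrite (le_lt_trans (ler_norm M))// ltrDl.
by apply: (lipM _ MM (y, z)); split; exact: inU.
Qed.

Lemma locally_lipschitz_continuous (R : realType) n (f : 'rV[R]_n -> R) :
  locally_lipschitz f -> continuous f.
Proof.
move=> fl x; have [r [L [r0 L0 lip]]] := locally_lipschitz_ball fl x.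
have near_ball (d : R) : 0 < d -> \forall y \near x, `|x - y| <= d.
  move=> d0; apply/nbhs_ballP; exists d => // y.
  by rewrite -ball_normE => /ltW.
(* [L] may vanish, so [e] is divided by [L + 1]. *)
have L1 : 0 < L + 1 by lra.
apply/(@cvgrPdist_le _ _ _ (nbhs (x : 'rV[R]_n))) => e e0.
apply: filterS2 (near_ball r r0) (near_ball _ (divr_gt0 e0 L1)) => y xy.
rewrite ler_pdivlMr// => h; apply: le_trans h.
apply: le_trans (lip x y _ xy) _; first by rewrite subrr normr0 ltW.
by rewrite mulrC ler_wpM2l// lerDl.
Qed.

(** * The penalty function, its minimisers and the normals they produce *)

Section Penalty.
Context {R : realType} {n m : nat}.
Variables (f : 'rV[R]_n -> R) (xbar : 'rV[R]_n).

(* w stands for the pair (x', y). *)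
Definition penalty (k : R) (x : 'rV[R]_n) (w : 'rV[R]_(n + m)) : R :=
  f x + k / 2 * (dot (x - lsubmx w) (x - lsubmx w) + dot (rsubmx w) (rsubmx w))
  + 2^-1 * dot (lsubmx w - xbar) (lsubmx w - xbar).

Lemma cvg_penalty (T : Type) (F : set_system T) {FF : Filter F} (k : R)
    (x_ : T -> 'rV[R]_n) (w_ : T -> 'rV[R]_(n + m))
    (x : 'rV[R]_n) (w : 'rV[R]_(n + m)) :
  {for x, continuous f} -> x_ @ F --> x -> w_ @ F --> w ->
  penalty k (x_ t) (w_ t) @[t --> F] --> penalty k x w.
Proof.
move=> fx xx ww.
have lw : lsubmx (w_ t) @[t --> F] --> lsubmx w.
  by apply: continuous_cvg ww; exact: continuous_lsubmx.
have rw : rsubmx (w_ t) @[t --> F] --> rsubmx w.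
  by apply: continuous_cvg ww; exact: continuous_rsubmx.
apply: cvgD; last first.
  apply: cvgM; first exact: cvg_cst.
  by apply: cvg_dot; apply: cvgB lw _; exact: cvg_cst.
apply: cvgD; first exact: continuous_cvg xx.
apply: cvgM; first exact: cvg_cst.
apply: cvgD; first by apply: cvg_dot; exact: cvgB xx lw.
exact: cvg_dot.
Qed.

(** Weierstrass on a compact set: in the sup norm, the ball around the concatenation [c] is the
    product of the two balls. *)
Lemma penalty_minimizer (k r : R) (A : set 'rV[R]_(n + m)) :
  0 <= r -> continuous f -> closed A -> A (row_mx xbar 0) ->
  exists (x : 'rV[R]_n) (w : 'rV[R]_(n + m)),
    [/\ `|xbar - x| <= r, `|row_mx xbar 0 - w| <= r, A w &
      forall x' w', `|xbar - x'| <= r -> `|row_mx xbar 0 - w'| <= r -> A w' ->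
        penalty k x w <= penalty k x' w'].
Proof.
move=> r0 fc cA A0.
pose c : 'rV[R]_(n + (n + m)) := row_mx xbar (row_mx xbar 0).
pose K := [set z : 'rV[R]_(n + (n + m)) | `|c - z| <= r /\ A (rsubmx z)].
have KE x w : `|xbar - x| <= r -> `|row_mx xbar 0 - w| <= r -> A w ->
    K (row_mx x w).
  move=> xr wr Aw; split; last by rewrite row_mxKr.
  by rewrite /c opp_row_mx add_row_mx; exact: normr_row_mx_le.
have cK : compact K.
  apply: bounded_closed_compact.
    exists (`|c| + r); split=> [|N cN z [zr _] /=]; first exact: num_real.
    rewrite (le_trans _ (ltW cN))//.
    have -> : z = c - (c - z) by rewrite subKr.
    by rewrite (le_trans (ler_normB _ _))// lerD2l.
  apply: closedI; first exact: closed_closed_ball_.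
  by apply: closed_comp cA => z _; exact: continuous_rsubmx.
have pc : continuous
    (fun z : 'rV[R]_(n + (n + m)) => penalty k (lsubmx z) (rsubmx z)).
  move=> z; apply: (@cvg_penalty _ (nbhs z)); first exact: fc.
    exact: continuous_lsubmx.
  exact: continuous_rsubmx.
have [||z zK zmin] := @EVT_min_rV R _
    (fun z : 'rV[R]_(n + (n + m)) => penalty k (lsubmx z) (rsubmx z)) K _ cK _.
- by exists c; apply: KE => //; rewrite subrr normr0.
- exact: continuous_subspaceT.
move: zK; rewrite inE => -[zr Az].
exists (lsubmx z), (rsubmx z); split=> //.
- rewrite (le_trans _ zr)// (le_trans _ (normr_lsubmx_le _))//.
  by rewrite linearB /= row_mxKl.
- rewrite (le_trans _ zr)// (le_trans _ (normr_rsubmx_le _))//.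
  by rewrite linearB /= row_mxKr.
- move=> x' w' xr wr Aw.
  by have := zmin (row_mx x' w'); rewrite inE row_mxKl row_mxKr; apply;
    exact: KE.
Qed.

(** Minimality bounds [f] below near [x] by a concave quadratic touching it at [x] with slope
    [- (k *: (x - lsubmx w))]; its curvature gives the proximal constant [k / 2]. *)
Lemma penalty_min_epi_normal (k : R) (x : 'rV[R]_n) (w : 'rV[R]_(n + m)) :
  0 <= k -> (\forall y \near x, penalty k x w <= penalty k y w) ->
  regular_normal_cone (epi f) (row_mx x (f x)%:M)
    (row_mx (- (k *: (x - lsubmx w))) (-1)%:M).
Proof.
move=> k0 xmin; apply: (@proximal_normal_regular _ _ _ _ _ (k / 2)).
  by rewrite /epi /= row_mxKl row_mxKr mxE eqxx mulr1n.
have lx : lsubmx z @[z --> row_mx x (f x)%:M] --> x.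
  have := @continuous_lsubmx R 1 n 1 (row_mx x (f x)%:M).
  by rewrite /continuous_at row_mxKl.
have lxmin : \forall z \near row_mx x (f x)%:M,
    penalty k x w <= penalty k (lsubmx z) w := lx _ xmin.
apply: filterS lxmin => z; rewrite /epi /penalty /= => zmin fz.
rewrite [dot _ (z - _)]dot_lrsubmx [dot (z - _) _]dot_lrsubmx.
rewrite [lsubmx (_ - _)]linearB [rsubmx (_ - _)]linearB /= !row_mxKl !row_mxKr.
have scalarE (c : R) : (c%:M : 'rV[R]_1) 0 0 = c by rewrite mxE mulr1n.
have subE : (rsubmx z - (f x)%:M) 0 0 = rsubmx z 0 0 - f x.
  by rewrite -[in RHS](scalarE (f x)) [LHS]mxE; congr (_ + _); rewrite mxE.
rewrite !dot_rV1 scalarE subE dotNl dotZl.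
move: (lsubmx z) (rsubmx z 0 0) zmin fz => y t zmin fz.
have := dot_sqrB (lsubmx w) x y.
(* The vertical part of the squared distance only enlarges the right-hand side. *)
have : 0 <= k * ((t - f x) * (t - f x)) by rewrite mulr_ge0// -expr2 sqr_ge0.
move=> ? E; move: zmin; rewrite E; lra.
Qed.

(** The vector is minus the gradient of the penalty in [w]. Its quadratic remainder has coefficient
    [(k + 1) / 2] in the first block and [k / 2] in the second, hence the proximal constant
    [(k + 1) / 2]. *)
Lemma penalty_min_set_normal (k : R) (x : 'rV[R]_n) (w : 'rV[R]_(n + m))
    (A : set 'rV[R]_(n + m)) :
  0 <= k -> A w ->
  (\forall w' \near w, A w' -> penalty k x w <= penalty k x w') ->
  regular_normal_cone A w
    (row_mx (k *: (x - lsubmx w) - (lsubmx w - xbar)) (- (k *: rsubmx w))).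
Proof.
move=> k0 Aw wmin.
apply: (@proximal_normal_regular _ _ _ _ _ ((k + 1) / 2)) => //.
apply: filterS wmin => w' wmin /wmin; rewrite /penalty => {}wmin.
rewrite [dot _ (w' - _)]dot_lrsubmx [dot (w' - _) _]dot_lrsubmx.
rewrite [lsubmx (_ - _)]linearB [rsubmx (_ - _)]linearB /= !row_mxKl !row_mxKr.
move: (lsubmx w) (rsubmx w) (lsubmx w') (rsubmx w') wmin => u p u' p' wmin.
rewrite dotDl dotNl dotZl dotNl dotZl.
have Ex := dot_sqrB x u u'.
have Exbar := dot_sqrB xbar u u'.
have Ep : dot p' p' = dot p p + 2 * dot p (p' - p) + dot (p' - p) (p' - p).
  by have := dot_sqrB 0 p p'; rewrite !subr0.
rewrite -(opprB u x) dotNl.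
have := dot_ge0 (p' - p); move: wmin.
rewrite (dot_sqrC x u) (dot_sqrC x u') Ex Exbar Ep; lra.
Qed.

End Penalty.

(** * Sequences of minimisers and their normals *)

(** This is the asymptotic form of stationarity, reached before AM-regularity enters: [xi_]
    converges, while no bound on [lambda_] is claimed. *)
Lemma penalization_sequence (R : realType) (n m : nat) (f : 'rV[R]_n -> R)
    (Phi : 'rV[R]_n -> set 'rV[R]_m) (xbar : 'rV[R]_n) :
  locally_lipschitz f -> closed (gph Phi) ->
  local_minimizer f (feasible_set Phi) xbar ->
  exists (x_ : nat -> 'rV[R]_n) (w_ : nat -> 'rV[R]_(n + m))
      (xi_ : nat -> 'rV[R]_n) (lambda_ : nat -> 'rV[R]_m) (xi : 'rV[R]_n),
    [/\ x_ @ \oo --> xbar, w_ @ \oo --> row_mx xbar 0, xi_ @ \oo --> xi,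
      forall j, regular_normal_cone (epi f) (row_mx (x_ j) (f (x_ j))%:M)
                  (row_mx (- xi_ j) (-1)%:M) &
      forall j, regular_normal_cone (gph Phi) (w_ j)
        (row_mx (xi_ j - (lsubmx (w_ j) - xbar)) (- lambda_ j))].
Proof.
move=> fl clPhi [feas /nbhs_ballP [r1 /= r10 r1min]].
have [r2 [L [r20 L0 lip]]] := locally_lipschitz_ball fl xbar.
have fc := locally_lipschitz_continuous fl.
(* The closed ball of radius [r] lies in the open ball where [xbar] is minimal and in the ball where
   [L] is a Lipschitz constant. *)
pose r := Num.min (r1 / 2) r2.
have r0 : 0 < r by rewrite lt_min r20 divr_gt0.
have rr2 : r <= r2 by rewrite ge_min lexx orbT.
have fmin y : `|xbar - y| <= r -> feasible_set Phi y -> f xbar <= f y.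
  move=> yr; apply: r1min; rewrite -ball_normE /=; apply: le_lt_trans yr _.
  by rewrite gt_min ltr_pdivrMr// ltr_pMr// ltr1n.
have flip y z : `|xbar - y| <= r -> `|xbar - z| <= r ->
    `|f y - f z| <= L * `|y - z|.
  by move=> yr zr; apply: lip; exact: le_trans rr2.
have gph0 : gph Phi (row_mx xbar 0) by rewrite /gph /= row_mxKl row_mxKr.
have xr : `|xbar - xbar| <= r by rewrite subrr normr0 ltW.
have wr : `|row_mx xbar 0 - row_mx xbar 0 : 'rV[R]_(n + m)| <= r.
  by rewrite subrr normr0 ltW.
have lr (w : 'rV[R]_(n + m)) : `|row_mx xbar 0 - w| <= r ->
    `|xbar - lsubmx w| <= r.
  apply: le_trans; rewrite (le_trans _ (normr_lsubmx_le _))//.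
  by rewrite linearB /= row_mxKl.
(* The shift keeps the parameter positive at index 0 and matches [harmonic]. *)
pose K (k : nat) : R := k.+1%:R.
have K0 k : 0 < K k by rewrite ltr0n.
have /choice [x_ /choice [w_ minP]] := fun k =>
  penalty_minimizer (K k) (ltW r0) fc clPhi gph0.
(* The competitor built from [xbar] and [row_mx xbar 0] has penalty exactly [f xbar]. *)
have pen_le k : penalty f xbar (K k) (x_ k) (w_ k) <= f xbar.
  have [_ _ _ /(_ _ _ xr wr gph0)] := minP k; rewrite {2}/penalty.
  rewrite row_mxKl row_mxKr !subrr /dot !mul0mx mxE addr0 !mulr0 !addr0.
  exact.
pose xi_ k := K k *: (x_ k - lsubmx (w_ k)).
(* Compare the minimiser (x, w) with (lsubmx w, w). *)
have xi_bound k : `|xi_ k| <= 2 * L.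
  have [xk wk Ak /(_ _ _ (lr _ wk) wk Ak)] := minP k.
  have fL : f (lsubmx (w_ k)) - f (x_ k) <= L * `|x_ k - lsubmx (w_ k)|.
    by rewrite distrC; apply: le_trans (ler_norm _) _; exact: flip (lr _ wk) xk.
  rewrite /penalty (subrr (lsubmx _)) /xi_ normrZ gtr0_norm//; move: fL.
  have -> : dot (0 : 'rV[R]_n) 0 = 0 by rewrite /dot mul0mx mxE.
  have := sqr_normr_le_dot (x_ k - lsubmx (w_ k)).
  move: (normr_ge0 (x_ k - lsubmx (w_ k))).
  rewrite le_eqVlt => /predU1P[<- *|]; first by rewrite mulr0 mulr_ge0.
  move: (`|_|) (dot _ _) => d D d0 dD fL pL.
  (* Minimality gives [K k / 2 * D <= L * d], and [d ^+ 2 <= D]; the positive factor [d] then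
     cancels. *)
  rewrite -(ler_pM2r d0); have := K0 k; nra.
have normr_le (d : nat) (a b : 'rV[R]_d) : `|a - b| <= r -> `|b| <= `|a| + r.
  move=> ab; rewrite -{1}(subKr a b) (le_trans (ler_normB _ _))//.
  by rewrite lerD2l.
(* Concatenation lets a single index map serve all three sequences. *)
have [|s [l [sj sl]]] := @bolzano_weierstrass_rV R _
  (fun k => row_mx (row_mx (x_ k) (w_ k)) (xi_ k)) (Num.max (Num.max
  (`|xbar| + r) (`|row_mx xbar 0 : 'rV[R]_(n + m)| + r)) (2 * L)) _.
  move=> k; have [xk wk _ _] := minP k.
  apply: normr_row_mx_le; last by rewrite le_max xi_bound orbT.
  by apply: normr_row_mx_le; rewrite !le_max normr_le ?orbT.
have [/cvg_row_mxE [xs ws] xis] := cvg_row_mxE sl.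
move: (lsubmx (lsubmx l)) (rsubmx (lsubmx l)) (rsubmx l) xs ws xis => x w xi.
move=> xs ws xis {l sl}.
have lws : lsubmx (w_ (s j)) @[j --> \oo] --> lsubmx w.
  by apply: continuous_cvg ws; exact: continuous_lsubmx.
have rws : rsubmx (w_ (s j)) @[j --> \oo] --> rsubmx w.
  by apply: continuous_cvg ws; exact: continuous_rsubmx.
have gphw : gph Phi w.
  apply: (closed_cvg _ clPhi _ _ ws); apply: nearW => j.
  by have [] := minP (s j).
have xbar_x : `|xbar - x| <= r.
  apply: (closed_cvg (closed_ball_ Num.norm xbar r) _ _ _ xs).
    exact: closed_closed_ball_.
  by apply: nearW => j; have [] := minP (s j).
pose gap j := dot (x_ (s j) - lsubmx (w_ (s j))) (x_ (s j) - lsubmx (w_ (s j)))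
  + dot (rsubmx (w_ (s j))) (rsubmx (w_ (s j))).
have gap_ge0 j : 0 <= gap j by rewrite addr_ge0// dot_ge0.
(* By [pen_le], [K (s j) * gap j] is at most twice the decrease of [f] from [xbar], hence at most
   [2 * L * r]; and [K (s j)] is at least [j.+1]. *)
have gap_le j : gap j <= 2 * L * r * harmonic j.
  have [xk _ _ _] := minP (s j).
  have fL : f xbar - f (x_ (s j)) <= L * r.
    apply: le_trans (ler_norm _) _; apply: le_trans (flip _ _ xr xk) _.
    exact: ler_wpM2l.
  have := pen_le (s j); rewrite /penalty -/(gap j).
  have := dot_ge0 (lsubmx (w_ (s j)) - xbar).
  move: (dot _ _) => D D0 pL; rewrite /harmonic /= ler_pdivlMr ?ltr0n//.
  have jK : j.+1%:R <= K (s j) by rewrite ler_nat ltnS sj.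
  by have := ler_wpM2l (gap_ge0 j) jK; lra.
have gap0 : dot (x - lsubmx w) (x - lsubmx w) + dot (rsubmx w) (rsubmx w) <= 0.
  rewrite -(mulr0 (2 * L * r)).
  apply: (@ler_cvg_to nat \oo _ R gap (fun j => 2 * L * r * harmonic j)).
  - by apply: cvgD; apply: cvg_dot => //; exact: cvgB.
  - by apply: cvgM cvg_harmonic; exact: cvg_cst.
  - by apply: nearW => j; exact: gap_le.
have dot_le0 d (u : 'rV[R]_d) : dot u u <= 0 -> u = 0.
  move=> /(le_trans (sqr_normr_le_dot u)) u0; apply/eqP.
  by rewrite -normr_eq0 -sqrf_eq0 eq_le u0 sqr_ge0.
have xlw : x = lsubmx w.
  apply/eqP; rewrite -subr_eq0; apply/eqP/dot_le0.
  by have := dot_ge0 (rsubmx w); lra.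
have rw0 : rsubmx w = 0.
  by apply: dot_le0; have := dot_ge0 (x - lsubmx w); lra.
(* The limit is feasible and lies in the ball, so [f xbar <= f x]; the limit of [pen_le] bounds
   [f x] plus the localising term by [f xbar], forcing that term to vanish. *)
have lwxbar : lsubmx w = xbar.
  apply/eqP; rewrite -subr_eq0; apply/eqP/dot_le0.
  have fx : f xbar <= f x.
    by apply: fmin => //; move: gphw; rewrite /gph /= rw0 -xlw.
  suff : f x + 2^-1 * dot (lsubmx w - xbar) (lsubmx w - xbar) <= f xbar by lra.
  apply: (@cvgr_to_le nat \oo _ R (fun j => f (x_ (s j))
    + 2^-1 * dot (lsubmx (w_ (s j)) - xbar) (lsubmx (w_ (s j)) - xbar))).
    apply: cvgD; first by apply: continuous_cvg xs; exact: fc.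
    apply: cvgM; first exact: cvg_cst.
    by apply: cvg_dot; apply: cvgB lws _; exact: cvg_cst.
  apply: nearW => j; have := pen_le (s j); rewrite /penalty -/(gap j).
  have := mulr_ge0 (ltW (K0 (s j))) (gap_ge0 j); lra.
have wE : w = row_mx xbar 0 by rewrite -[w]hsubmxK lwxbar rw0.
rewrite xlw lwxbar in xs; rewrite wE in ws.
(* Strictly inside the balls their constraints are inactive, so minimality over the balls becomes
   local minimality. *)
have near_ball d (a b : 'rV[R]_d) : `|a - b| < r ->
    \forall y \near b, `|a - y| <= r.
  move=> ab; apply/nbhs_ballP; exists (r - `|a - b|) => [|y].
    by rewrite /= subr_gt0.
  rewrite -ball_normE /= => yb.
  rewrite -(subrKA b a (- y)) (le_trans (ler_normD _ _))//; lra.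
have [N _ Nr] : \forall j \near \oo,
    `|xbar - x_ (s j)| < r /\ `|row_mx xbar 0 - w_ (s j)| < r.
  by near=> j; split; near: j; exact: cvgr_dist_lt.
(* Dropping the first [N] indices makes the strict bounds hold at every index. *)
pose sN j := s (j + N)%N.
have sNr j : `|xbar - x_ (sN j)| < r /\ `|row_mx xbar 0 - w_ (sN j)| < r.
  by apply: Nr; rewrite /= leq_addl.
exists (x_ \o sN), (w_ \o sN), (xi_ \o sN),
  (fun j => K (sN j) *: rsubmx (w_ (sN j))), xi; split.
- by rewrite -(cvg_shiftn N) in xs.
- by rewrite -(cvg_shiftn N) in ws.
- by rewrite -(cvg_shiftn N) in xis.
- move=> j; have [xk wk Ak pmin] := minP (sN j).
  apply: penalty_min_epi_normal; first exact: ltW.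
  have := near_ball _ _ _ (sNr j).1; apply: filterS => y yr; exact: pmin.
- move=> j; have [xk wk Ak pmin] := minP (sN j).
  apply: (@penalty_min_set_normal _ _ _ f) => //.
  have := near_ball _ _ _ (sNr j).2; apply: filterS => y yr Ay; exact: pmin.
Unshelve. all: by end_near. Qed.

(** * Passage to the limit by AM-regularity *)

Theorem theorem3p9 (R : realType) (n m : nat) (f : 'rV[R]_n -> R)
    (Phi : 'rV[R]_n -> set 'rV[R]_m) (xbar : 'rV[R]_n)
    (f_lip : locally_lipschitz f)
    (Phi_closed : closed (gph Phi))
    (xbar_min : local_minimizer f (feasible_set Phi) xbar)
    (xbar_AM : AM_regular Phi xbar) :
  M_stationary f Phi xbar.
Proof.
have [x_ [w_ [xi_ [lambda_ [xi [xx ww xixi epiN gphN]]]]]] :=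
  penalization_sequence f_lip Phi_closed xbar_min.
have fx : f (x_ j) @[j --> \oo] --> f xbar.
  by apply: continuous_cvg xx; exact: locally_lipschitz_continuous.
have lw : lsubmx (w_ j) @[j --> \oo] --> xbar.
  rewrite -(row_mxKl xbar (0 : 'rV[R]_m)).
  by apply: continuous_cvg ww; exact: continuous_lsubmx.
have rw : rsubmx (w_ j) @[j --> \oo] --> (0 : 'rV[R]_m).
  rewrite -(row_mxKr xbar (0 : 'rV[R]_m)).
  by apply: continuous_cvg ww; exact: continuous_rsubmx.
(* [xi] lies in the outer limit because the perturbation [lsubmx (w_ j) - xbar] tends to 0. The
   resulting [lambda] comes from AM-regularity, not as a limit of [lambda_]. *)
have [_ /(_ xi) [|lambda _ xiN]] := xbar_AM.
  exists (fun j => lsubmx (w_ j)), (fun j => rsubmx (w_ j)),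
    (fun j => xi_ j - (lsubmx (w_ j) - xbar)); split=> //.
    rewrite -[X in _ --> X]subr0 -(subrr xbar).
    by apply: cvgB => //; apply: cvgB => //; exact: cvg_cst.
  move=> j; exists (lambda_ j) => //; rewrite /coderivative /= hsubmxK.
  have [gphj _] := gphN j; split=> //.
  (* Constant sequences show that a regular normal is a limiting one. *)
  by exists (fun=> w_ j), (fun=> row_mx (xi_ j - (lsubmx (w_ j) - xbar))
    (- lambda_ j)); split=> // [|]; exact: cvg_cst.
exists lambda; exists (- xi); last by exists xi => //; rewrite addNr.
split; first by rewrite /epi /= row_mxKl row_mxKr mxE mulr1n.
(* The base points on the graph of [f] converge by continuity, so [- xi] is a limiting
   subgradient. *)
exists (fun j => row_mx (x_ j) (f (x_ j))%:M),
  (fun j => row_mx (- xi_ j) (-1)%:M); split=> //.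
- by move=> j; have [] := epiN j.
- apply: cvg_row_mx => //; apply: cvg_mx => i j.
  by rewrite !ord1 mxE; under eq_fun do rewrite mxE.
- by apply: cvg_row_mx; [exact: cvgN|exact: cvg_cst].
Qed.
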